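(* Suppose $J:\mathcal{P}(\mathcal{X})\to\mathbb{R}$ is convex, and the von Mises derivative of $J$ exists at $\mu^*\in\mathcal{P}(\mathcal{X})$ along any direction $\nu-\mu^*$ with $\nu\in\mathcal{P}(\mathcal{X})$. Let $h_{\mu^*}$ be the influence function of $J$ at $\mu^*$. Then $\mu^*$ is optimal, that is, $J(\nu)\ge J(\mu^* )$ for all $\nu\in\mathcal{P}(\mathcal{X})$, if and only if $h_{\mu^*}(x)\ge0$ for all $x\in\mathcal{X}$.
   Context: $\mathcal{X}$ is a nonempty compact subset of $\mathbb{R}^d$, $\mathcal{P}(\mathcal{X})$ is the set of Borel probability measures on $\mathcal{X}$, and $\delta_x$ is the Dirac measure at $x$. The functional $J$ is convex if $J((1-t)\mu+t\nu)\le(1-t)J(\mu)+tJ(\nu)$ for all $\mu,\nu\in\mathcal{P}(\mathcal{X})$, $t\in[0,1]$. The influence function of $J$ at $\mu$ is $h_\mu(x)=\lim_{t\to0^+}\frac1t\{J(\mu+t(\delta_x-\mu))-J(\mu)\}$, $x\in\mathcal{X}$. The von Mises derivative of $J$ at $\mu$ is $J'_\mu(\nu)=\lim_{t\to0^+}\frac1t\{J(\mu+t(\nu-\mu))-J(\mu)\}$, $\nu\in\mathcal{P}(\mathcal{X})$; it exists at $\mu$ if these limits exist and there is a measurable $\phi_\mu:\mathcal{X}\to\mathbb{R}$, integrable with respect to every $\nu\in\mathcal{P}(\mathcal{X})$, with $J'_\mu(\nu)=\int\phi_\mu\,\mathrm{d}(\nu-\mu)$ for all $\nu\in\mathcal{P}(\mathcal{X})$.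 *)

(* Defs.v *)
From HB Require Import structures.
From mathcomp Require Import all_boot all_order all_algebra.
From mathcomp Require Import all_classical all_reals all_analysis.

Set Implicit Arguments.
Unset Strict Implicit.
Unset Printing Implicit Defensive.
Import Order.TTheory GRing.Theory Num.Theory.
Import numFieldNormedType.Exports.

Local Open Scope classical_set_scope.
Local Open Scope ring_scope.

(* A [measurableType] must be pointed, so the subtype of a set X (with its
   subspace topology) carries a proof that X is nonempty; the choice of the
   point plays no role. *)
Definition subspace_type (T : topologicalType) (X : set T) (X0 : X !=set0) : Type :=
  set_type X.

Section subspace_type.
Variables (T : topologicalType) (X : set T) (X0 : X !=set0).

Let x0 : subspace_type X0 := SigSub (mem_set (projT2 (cid X0))).

HB.instance Definition _ := Topological.copy (subspace_type X0) (set_type X).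
HB.instance Definition _ := isPointed.Build (subspace_type X0) x0.

End subspace_type.

Definition borel (T : topologicalType) (X : set T) (X0 : X !=set0) :=
  g_sigma_algebraType (@open (subspace_type X0)).

Definition borel_probability (R : realType) (T : topologicalType) (X : set T)
  (X0 : X !=set0) := probability (borel X0) R.

Section mixture.
Context d (T : measurableType d) (R : realType).

(* The identity on [0, 1]; it makes [mixture] total in its real parameter. *)
Definition clamp01 (t : R) : R := Num.max 0 (Num.min t 1).

Lemma clamp01_ge0 (t : R) : 0 <= clamp01 t.
Proof. by rewrite /clamp01 le_max lexx. Qed.

Lemma clamp01_le1 (t : R) : 0 <= 1 - clamp01 t.
Proof. by rewrite /clamp01 subr_ge0 ge_max ler01 ge_min lexx orbT. Qed.

Lemma clamp01_id (t : R) : 0 <= t <= 1 -> clamp01 t = t.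
Proof. by case/andP=> t0 t1; rewrite /clamp01 (min_l t1) (max_r t0). Qed.

Variables (mu nu : probability T R) (t : R).

(* (1 - t) mu + t nu = mu + t (nu - mu), for t in [0, 1]: see [mixtureE]. *)
Definition mixture : set T -> \bar R :=
  measure_add (mscale (NngNum (clamp01_le1 t)) mu)
              (mscale (NngNum (clamp01_ge0 t)) nu).

HB.instance Definition _ := Measure.on mixture.

Let mixture_setT : mixture setT = 1%E.
Proof.
rewrite /mixture measure_addE.
transitivity ((1 - clamp01 t)%:E * mu setT + (clamp01 t)%:E * nu setT)%E => //.
by rewrite !probability_setT !mule1 -EFinD subrK.
Qed.

HB.instance Definition _ :=
  Measure_isProbability.Build _ _ _ mixture mixture_setT.

Lemma mixtureE (A : set T) : 0 <= t <= 1 ->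
  mixture A = ((1 - t)%:E * mu A + t%:E * nu A)%E.
Proof.
move=> t01; rewrite /mixture measure_addE.
transitivity ((1 - clamp01 t)%:E * mu A + (clamp01 t)%:E * nu A)%E => //.
by rewrite clamp01_id.
Qed.

End mixture.

Section functional.
Context d (T : measurableType d) (R : realType).
Implicit Types (J : probability T R -> R) (mu nu : probability T R).

(* The elements of [probability T R] are functions on all subsets of T, whose
   values on non-measurable sets are irrelevant. A functional on probability
   measures is one that depends only on the values on measurable sets. *)
Definition measure_functional J :=
  forall mu nu, (forall A, measurable A -> mu A = nu A) -> J mu = J nu.

Definition convex_functional J :=
  forall mu nu (t : R), 0 <= t <= 1 ->
    J (mixture mu nu t) <= (1 - t) * J mu + t * J nu.

Definition difference_quotient J mu nu (t : R) : R :=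
  t^-1 * (J (mixture mu nu t) - J mu).

Definition von_mises_derivative J mu nu : R :=
  lim (difference_quotient J mu nu t @[t --> 0^'+]).

(* The integral of phi against the signed measure nu - mu is the difference of
   its (finite) integrals against nu and mu. *)
Definition von_mises_differentiable J mu :=
  (forall nu, cvg (difference_quotient J mu nu t @[t --> 0^'+])) /\
  exists phi : T -> R,
    [/\ measurable_fun setT phi,
        forall nu, nu.-integrable setT (EFin \o phi) &
        forall nu, von_mises_derivative J mu nu =
          \int[nu]_x phi x - \int[mu]_x phi x].

Definition influence_function J mu (x : T) : R :=
  lim (difference_quotient J mu (\d_x : probability T R) t @[t --> 0^'+]).

Definition optimal J mu := forall nu, J nu >= J mu.

End functional.

(* Main.v *)
(** Along the segment from mu to nu, convexity bounds every difference quotient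
    by [J nu - J mu], so the directional derivative [J'_mu(nu)] is at most
    [J nu - J mu]; it is nonnegative when mu is optimal. Writing
    [J'_mu(nu) = int phi dnu - int phi dmu], the influence function is
    [h x = J'_mu(delta_x) = phi x - int phi dmu], so [h >= 0] says that phi is
    bounded below by [int phi dmu], and integrating this against nu gives
    [J'_mu(nu) >= 0]. *)
Require Import Defs.
From mathcomp Require Import all_boot all_order all_algebra.
From mathcomp Require Import all_classical all_reals all_analysis.
From mathcomp Require Import measurable_realfun.
Import Order.TTheory GRing.Theory Num.Theory.
Import numFieldNormedType.Exports.
Local Open Scope classical_set_scope.
Local Open Scope ring_scope.

Section von_mises.
Context {d} {T : measurableType d} {R : realType}.
Implicit Types (J : probability T R -> R) (mu nu : probability T R).

Lemma difference_quotient_ge0 J mu nu (t : R) :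
  optimal J mu -> 0 < t -> 0 <= difference_quotient J mu nu t.
Proof.
move=> opt t0; apply: mulr_ge0; first by rewrite invr_ge0 ltW.
(* The clamping makes [mixture] a probability measure for every real [t], so optimality applies to
   it. *)
by rewrite subr_ge0; exact: opt.
Qed.

Lemma difference_quotient_le J mu nu (t : R) :
  convex_functional J -> 0 < t -> t <= 1 ->
  difference_quotient J mu nu t <= J nu - J mu.
Proof.
move=> cvxJ t0 t1; rewrite /difference_quotient ler_pdivrMl//.
have t01 : 0 <= t <= 1 by rewrite ltW.
rewrite lerBlDr (le_trans (cvxJ mu nu t t01))// mulrBl mul1r mulrBr.
by rewrite [leLHS]addrC addrA addrAC.
Qed.

Lemma von_mises_derivative_ge0 J mu nu :
  cvg (difference_quotient J mu nu t @[t --> 0^'+]) ->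
  optimal J mu -> 0 <= von_mises_derivative J mu nu.
Proof.
move=> cvgJ opt; apply: limr_ge => //.
near=> t; apply: difference_quotient_ge0 => //.
Unshelve. all: by end_near. Qed.

Lemma von_mises_derivative_le J mu nu :
  cvg (difference_quotient J mu nu t @[t --> 0^'+]) ->
  convex_functional J -> von_mises_derivative J mu nu <= J nu - J mu.
Proof.
move=> cvgJ cvxJ; apply: limr_le => //.
near=> t; apply: difference_quotient_le => //.
(* Convexity only covers [t] in [0, 1], but the limit sees only small [t]. *)
by near: t; exact: nbhs_right_le.
Unshelve. all: by end_near. Qed.

Lemma Rintegral_dirac (phi : T -> R) (x : T) :
  measurable_fun setT phi -> \int[\d_x]_y phi y = phi x.
Proof.
move=> mphi; rewrite /Rintegral integral_dirac ?diracT ?mul1e//.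
exact/measurable_EFinP.
Qed.

Lemma Rintegral_probability_ge nu (phi : T -> R) (c : R) :
  nu.-integrable setT (EFin \o phi) -> (forall x, c <= phi x) ->
  c <= \int[nu]_x phi x.
Proof.
move=> iphi cphi.
(* Total mass 1 turns [c] into an integral, so monotonicity applies. *)
have -> : c = \int[nu]_x cst c x.
  by rewrite Rintegral_cst// [X in fine X]probability_setT mulr1.
apply: le_Rintegral => //.
exact: finite_measure_integrable_cst.
Qed.

Lemma optimal_influence_function J mu :
  convex_functional J -> von_mises_differentiable J mu ->
  optimal J mu <-> (forall x, 0 <= influence_function J mu x).
Proof.
move=> cvxJ [cvgJ [phi [mphi iphi derJ]]]; split=> [opt x|h0 nu].
  (* By conversion, [influence_function J mu x] is the derivative towards [\d_x]. *)
  exact: von_mises_derivative_ge0.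
rewrite -subr_ge0; apply: le_trans (von_mises_derivative_le _ _ _ (cvgJ nu) cvxJ).
(* The lower bound [c] for [phi] is its integral against [mu]; evaluating [derJ] at [\d_x] turns
   [h0 x] into this bound. *)
rewrite derJ subr_ge0; apply: Rintegral_probability_ge => // x.
have := h0 x; rewrite -[influence_function _ _ _]/(von_mises_derivative _ _ _).
by rewrite derJ subr_ge0 Rintegral_dirac.
Qed.

End von_mises.

Theorem lemma1 (R : realType) (d : nat) (X : set 'rV[R]_d)
    (X0 : X !=set0) (cptX : compact X)
    (J : borel_probability R X0 -> R) (mustar : borel_probability R X0)
    (J_measure : measure_functional J)
    (J_convex : convex_functional J)
    (J_diff : von_mises_differentiable J mustar) :
  optimal J mustar <-> (forall x : borel X0, 0 <= influence_function J mustar x).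
Proof. exact: optimal_influence_function. Qed.
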